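(* There exists a polynomial of degree $3$ with rational coefficients none of whose roots can be obtained on the real calculator. For example, $8x^3-6x+1$ is such a polynomial.
   Context: A real number $x$ can be obtained on the real calculator if there is a finite sequence of real numbers ending with $x$, each term of which is either $1$, or the sum, difference, product or quotient (with nonzero divisor) of two earlier terms, or the real $n$-th root of an earlier term for some integer $n\ge 2$ (where for even $n$ the earlier term must be nonnegative). All numbers involved are real. *)

(* Defs.v *)
From HB Require Import structures.
From mathcomp Require Import all_boot all_order all_algebra.
From mathcomp Require Import reals.

Set Implicit Arguments.
Unset Strict Implicit.
Unset Printing Implicit Defensive.

Import Order.TTheory GRing.Theory Num.Theory.
Local Open Scope ring_scope.

(* For even n the real n-th root is the nonnegative one. *)
Definition is_real_nth_root (R : realType) (n : nat) (a y : R) : Prop :=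
  y ^+ n = a /\ (~~ odd n -> 0 <= a /\ 0 <= y).

Definition calculator_step (R : realType) (earlier : seq R) (y : R) : Prop :=
  y = 1
  \/ (exists a b : R, [/\ a \in earlier, b \in earlier &
        [\/ y = a + b, y = a - b, y = a * b | b != 0 /\ y = a / b]])
  \/ (exists (n : nat) (a : R),
        [/\ (2 <= n)%N, a \in earlier & is_real_nth_root n a y]).

Definition calculator_sequence (R : realType) (s : seq R) : Prop :=
  forall k : nat, (k < size s)%N -> calculator_step (take k s) (nth 0 s k).

Definition calculator_obtainable (R : realType) (x : R) : Prop :=
  exists s : seq R, calculator_sequence (rcons s x).

(* Only real roots are quantified over: a root that is not real is never
   obtainable, as calculator sequences consist of real numbers. *)
Definition cubic_without_obtainable_root (R : realType) (p : {poly rat}) : Prop :=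
  size p = 4%N /\
  forall x : R, root (map_poly ratr p) x -> ~ calculator_obtainable x.

(* Main.v *)
Require Import Defs.
From mathcomp Require Import all_boot all_order all_algebra all_field.
From mathcomp Require Import boolp reals complex ring zify.

Import Order.TTheory GRing.Theory Num.Theory.
Local Open Scope ring_scope.

Set Implicit Arguments.
Unset Strict Implicit.
Unset Printing Implicit Defensive.

(** This is the casus irreducibilis: if a cubic f with rational coefficients has
three real roots, none of them rational, then no root of f can be written with
real radicals ([casus_irreducibilis]).

Along a calculator sequence, one keeps a field F of real numbers that contains
the terms seen so far and over which f has no root. The field operations do not
leave F, so the only thing to show is that f still has no root in F(y) when y is
real and a power of y with positive exponent lies in F
([cubic_root_descends_radical]). Let n be the least such exponent and y ^+ n =
b. Then 'X^n - b is irreducible over F: the roots of a factor of degree d > 0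
have absolute value |y|, so, up to sign, its normalized constant term is y ^+ d,
which forces d >= n ([size_annihilator]). Let g(y), with g over F of degree less
than n, be a root of f. By irreducibility g(z) is also a root of f, hence real,
for each of the n complex numbers z with z ^+ n = b. Since the conjugate of z is
y ^+ 2 / z, the equality of g(z) with its conjugate relates the coefficients of
index i and n - i of g, and minimality of n forces all of them to vanish but
those of index 0 and n / 2 ([horner_real_conjugates_square]). So g(y) has degree
at most 2 over F, and a cubic that has such a root also has a root in F
([cubic_root_of_common_quadratic_root]).

The roots of 8x^3 - 6x + 1 are the cosines of 40, 80 and 160 degrees. They are
real because x = (t + 1/t) / 2 gives t^6 + t^3 + 1 = 0, hence t^9 = 1
([nonagon_cubic_real]), and a parity argument shows that they are irrational
([nonagon_cubic_rootless]). *)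

(** * Adjoining a real radical to a field of real numbers *)

(** The greatest common divisor of f and q is defined over F and has degree 1 or
2, so either it or its cofactor in f is linear. *)
Lemma cubic_root_of_common_quadratic_root (F L : fieldType)
    (iota : {rmorphism F -> L}) (f q : {poly F}) (r : L) :
  size f = 4%N -> q != 0 -> (size q <= 3)%N ->
  root (map_poly iota f) r -> root (map_poly iota q) r ->
  exists x, root f x.
Proof.
move=> size_f nz_q size_q fr qr; pose g := gcdp f q.
have nz_g : g != 0 by rewrite gcdp_eq0 (negPf nz_q) andbF.
have gr : root (map_poly iota g) r by rewrite gcdp_map root_gcd fr.
have size_g : (1 < size g < size f)%N.
  rewrite -(size_map_poly iota g) (root_size_gt1 _ gr) ?map_poly_eq0 //=.
  rewrite size_map_poly size_f ltnS (leq_trans _ size_q) //.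
  by rewrite dvdp_leq ?dvdp_gcdr.
have [|x fx] := reducible_cubic_root _ size_g (dvdp_gcdl f q).
  by rewrite size_f.
by exists x.
Qed.

(** The field of real numbers F is handled through an embedding iota into an
algebraically closed field C, where conjugates and absolute values of all roots
are available. *)
Section MinimalRadical.

Variables (C : numClosedFieldType) (F : fieldType) (iota : {rmorphism F -> C}).
Hypothesis iota_real : forall x, iota x \is Num.real.

Variables (y : C) (n : nat) (b : F).
Hypothesis y_real : y \is Num.real.
Hypothesis n_gt0 : (0 < n)%N.
Hypothesis y_pow_n : y ^+ n = iota b.
Hypothesis n_min :
  forall (m : nat) (c : F), (0 < m)%N -> y ^+ m = iota c -> (n <= m)%N.

Lemma pow_in_field_dvdn (m : nat) (c : F) : y ^+ m = iota c -> (n %| m)%N.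
Proof.
move=> ymc; have [y0|nz_y] := eqVneq y 0.
  suff -> : n = 1%N by rewrite dvd1n.
  apply/eqP; rewrite eqn_leq n_gt0 andbT.
  by apply: (@n_min 1%N 0) => //; rewrite y0 rmorph0 expr1.
apply: contraT; rewrite /dvdn -lt0n => mod_gt0.
have nz_b : iota b != 0 by rewrite -y_pow_n expf_neq0.
have /(n_min mod_gt0) : y ^+ (m %% n) = iota (c / b ^+ (m %/ n)).
  rewrite rmorphM fmorphV rmorphXn -y_pow_n -ymc {2}(divn_eq m n) exprD.
  by rewrite -exprM mulnC mulrC mulKf // mulnC expf_neq0.
by rewrite leqNgt ltn_mod n_gt0.
Qed.

(** All the roots of the common divisor m of p and 'X^n - b have absolute value
|y|, so the constant term of m, divided by its leading coefficient, is plus or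
minus y ^+ (deg m); as n is minimal, deg m >= n. *)
Lemma size_annihilator (p : {poly F}) :
  p != 0 -> root (map_poly iota p) y -> (n < size p)%N.
Proof.
move=> nz_p py; pose m := gcdp p ('X^n - b%:P).
have nz_m : m != 0 by rewrite gcdp_eq0 (negPf nz_p).
have map_Xnb : map_poly iota ('X^n - b%:P) = 'X^n - (iota b)%:P.
  by rewrite rmorphB /= map_polyXn map_polyC.
have my : root (map_poly iota m) y.
  by rewrite gcdp_map root_gcd py map_Xnb rootE !hornerE y_pow_n subrr.
have [rs def_m] := closed_field_poly_normal (map_poly iota m).
have nz_lc : lead_coef m != 0 by rewrite lead_coef_eq0.
have nz_lcC : iota (lead_coef m) != 0 by rewrite fmorph_eq0.
rewrite lead_coef_map in def_m.
have size_m : size m = (size rs).+1.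
  by rewrite -(size_map_poly iota) def_m size_scale // size_prod_XsubC.
have norm_rs z : z \in rs -> `|z| = `|y|.
  move=> z_rs; apply/eqP; rewrite -(@eqrXn2 _ n) ?normr_ge0 // -!normrX y_pow_n.
  have : root (map_poly iota m) z by rewrite def_m rootZ // root_prod_XsubC.
  rewrite gcdp_map root_gcd map_Xnb => /andP[_].
  by rewrite rootE !hornerE subr_eq0 => /eqP->.
have m0 : iota m`_0 = iota (lead_coef m) * \prod_(z <- rs) - z.
  rewrite -coef_map -horner_coef0 def_m hornerZ horner_prod; congr (_ * _).
  by apply: eq_bigr => z _; rewrite !hornerE.
have norm_pow : `|y ^+ size rs| = `|iota (m`_0 / lead_coef m)|.
  rewrite fmorph_div m0 mulrC mulKf // normr_prod normrX.
  under eq_big_seq => z /norm_rs nz do rewrite normrN nz.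
  by rewrite big_const_seq count_predT iter_mulr_1.
have size_rs : (0 < size rs)%N.
  rewrite -ltnS -size_m -(size_map_poly iota).
  by rewrite (root_size_gt1 _ my) ?map_poly_eq0.
suff [c ypc] : exists c, y ^+ size rs = iota c.
  rewrite (leq_trans (n := (size rs).+1)) ?ltnS ?(n_min size_rs ypc) //.
  by rewrite -size_m dvdp_leq ?dvdp_gcdl.
move/eqP: norm_pow; rewrite real_eqr_norm2 ?rpredX //.
case/orP=> /eqP ->; first by eexists.
by exists (- (m`_0 / lead_coef m)); rewrite [RHS]rmorphN.
Qed.

Lemma binomial_dvd_annihilator (p : {poly F}) :
  root (map_poly iota p) y -> 'X^n - b%:P %| p.
Proof.
move=> py; have monic_Xnb : 'X^n - b%:P \is monic by rewrite monicXnsubC.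
apply: contraT => nz_mod.
have map_Xnb : (map_poly iota ('X^n - b%:P)).[y] = 0.
  by rewrite rmorphB /= map_polyXn map_polyC !hornerE y_pow_n subrr.
have mod_y : root (map_poly iota (p %% ('X^n - b%:P))) y.
  move: py; rewrite {1}(divp_eq p ('X^n - b%:P)) rmorphD rmorphM /=.
  by rewrite !rootE hornerD hornerM map_Xnb mulr0 add0r.
have := size_annihilator nz_mod mod_y.
by rewrite ltnNge -ltnS -(size_XnsubC b n_gt0) ltn_modpN0 ?monic_neq0.
Qed.

Lemma real_conj_horner (p : {poly F}) (z : C) :
  ((map_poly iota p).[z])^* = (map_poly iota p).[z^*].
Proof.
rewrite -horner_map -map_poly_comp; congr _.[_].
by apply: eq_map_poly => x /=; rewrite conj_Creal.
Qed.

(** Let z ^+ n = y ^+ n and let w be the conjugate of z. Then |z| = |y|, so w =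
y ^+ 2 / z. Multiplied by z ^+ n to clear denominators, g(z) = g(w) says that z
* D(z) = 0, where D has degree less than n - 1; the n choices of z force D = 0,
that is g_i * y ^+ n = g_(n - i) * y ^+ (2 (n - i)) for 0 < i < n. So, reading
the relation of index n - i, g_i <> 0 puts y ^+ (2 i) in F; then n divides 2 i,
and i = n / 2. Hence the square of g(y) - g_0 is 0 or g_(n/2) ^+ 2 * b. *)
Lemma horner_real_conjugates_square (g : {poly F}) :
    y != 0 -> (size g <= n)%N ->
    (forall z, z ^+ n = y ^+ n -> (map_poly iota g).[z] \is Num.real) ->
  exists d, ((map_poly iota g).[y] - iota g`_0) ^+ 2 = iota d.
Proof.
move=> nz_y size_g g_real; have [k def_n] : exists k, n = k.+1.
  by exists n.-1; rewrite prednK.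
pose G := map_poly iota g.
have size_G : (size G <= k.+1)%N by rewrite size_map_poly -def_n.
pose D := \poly_(i < k) (G`_i.+1 * y ^+ n - G`_(k - i) * (y ^+ 2) ^+ (k - i)).
have D_root z : z ^+ n = y ^+ n -> root D z.
  move=> zn; have nz_z : z != 0.
    by have := expf_neq0 n nz_y; rewrite -zn expf_eq0 n_gt0.
  have norm_z : z * z^* = y ^+ 2.
    rewrite -normCK -(real_normK y_real); congr (_ ^+ 2); apply/eqP.
    by rewrite -(@eqrXn2 _ n) ?normr_ge0 // -!normrX zn.
  have Gz : G.[z] = G.[z^*] by rewrite -real_conj_horner conj_Creal ?g_real.
  have : z ^+ n * (G.[z] - G.[z^*]) = 0 by rewrite Gz subrr mulr0.
  rewrite !(horner_coef_wide _ size_G) !big_ord_recl !expr0 opprD addrACA subrr.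
  rewrite add0r mulrBr mulr_sumr [X in _ - X]mulr_sumr.
  rewrite [X in _ - X](reindex_inj rev_ord_inj) /= -sumrB.
  have -> : \sum_(i < k) (z ^+ n * (G`_(bump 0 i) * z ^+ bump 0 i) -
      z ^+ n * (G`_(bump 0 (k - i.+1)) * z^* ^+ bump 0 (k - i.+1))) = z * D.[z].
    rewrite horner_poly mulr_sumr; apply: eq_bigr => i _.
    have lt_ik := ltn_ord i; rewrite /bump !add1n -zn.
    rewrite (_ : (k - i.+1).+1 = (k - i)%N); last by lia.
    rewrite -norm_z exprMn {2}def_n.
    rewrite (_ : k.+1 = (i.+1 + (k - i))%N); last by lia.
    by rewrite exprD exprS; ring.
  by move/eqP; rewrite mulf_eq0 (negPf nz_z).
(* D vanishes at the n numbers y * z, with z an n-th root of 1. *)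
have D0 : D = 0.
  have [rs def_rs] := closed_field_poly_normal ('X^n - 1 : {poly C}).
  rewrite (monicP (monicXnsubC 1 n_gt0)) scale1r in def_rs.
  have size_rs : size rs = n.
    apply: succn_inj.
    by rewrite -(size_XnsubC (1 : C) n_gt0) def_rs size_prod_XsubC.
  have uniq_rs : uniq rs.
    by rewrite -separable_prod_XsubC -def_rs separable_Xn_sub_1 // pnatr_eq0
       -lt0n.
  have : (size D <= k)%N by exact: size_poly.
  apply: contraTeq => nz_D; rewrite -ltnNge ltnW // -def_n -size_rs.
  rewrite -(size_map (fun z => y * z)).
  apply: max_poly_roots => //; last by rewrite map_inj_uniq //; exact: mulfI.
  apply/allP => _ /mapP[z z_rs ->]; apply: D_root; rewrite exprMn.
  have : root ('X^n - 1) z by rewrite def_rs root_prod_XsubC.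
  by rewrite rootE !hornerE subr_eq0 => /eqP->; rewrite mulr1.
have coef_g i : (0 < i < n)%N -> g`_i != 0 -> (i + i)%N = n.
  case/andP=> i_gt0 i_lt_n nz_gi.
  have : D`_(k - i) = 0 by rewrite D0 coef0.
  rewrite coef_poly ifT; last by lia.
  rewrite (_ : k - (k - i) = i)%N; last by lia.
  rewrite -exprM !coef_map y_pow_n => /eqP; rewrite subr_eq0 => /eqP eq_coef.
  have : y ^+ (2 * i) = iota (g`_(k - i).+1 * b / g`_i).
    by rewrite fmorph_div rmorphM eq_coef mulrC mulKf ?fmorph_eq0.
  by move/pow_in_field_dvdn/dvdnP=> [[|[|c]]]; lia.
have expand : G.[y] - iota g`_0 = \sum_(i < k) iota g`_i.+1 * y ^+ i.+1.
  rewrite (horner_coef_wide _ size_G) big_ord_recl coef_map expr0 mulr1 addrC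
    addKr.
  by apply: eq_bigr => i _; rewrite /= /bump add1n coef_map.
rewrite -/G expand.
case: (pickP (fun i : 'I_k => g`_i.+1 != 0)) => [h nz_h | g0]; last first.
  exists 0; rewrite big1 ?rmorph0 ?expr0n // => i _.
  by move/negbFE/eqP: (g0 i) => ->; rewrite rmorph0 mul0r.
have double_h : (h.+1 + h.+1)%N = n.
  by apply: coef_g nz_h; have := ltn_ord h; lia.
exists (g`_h.+1 ^+ 2 * b); rewrite (bigD1 h) //= big1 ?addr0 => [|i ne_ih].
  by rewrite exprMn rmorphM rmorphXn -y_pow_n -double_h exprD expr2.
have [->|nz_i] := eqVneq g`_i.+1 0; first by rewrite rmorph0 mul0r.
case/eqP: ne_ih; apply: val_inj => /=.
have double_i : (i.+1 + i.+1)%N = n.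
  by apply: coef_g nz_i; have := ltn_ord i; lia.
by lia.
Qed.

(** The relation f(q(y)) = 0 is divisible by 'X^n - b, so it also holds at the
other roots of this polynomial. *)
Lemma cubic_root_descends (f q : {poly F}) :
    size f = 4%N ->
    (forall z, root (map_poly iota f) z -> z \is Num.real) ->
    root (map_poly iota f) (map_poly iota q).[y] ->
  exists x, root f x.
Proof.
move=> size_f f_real fq; have [y0|nz_y] := eqVneq y 0.
  exists q.[0]; rewrite -(fmorph_root iota).
  by rewrite -horner_map /= rmorph0 -y0.
have monic_Xnb : 'X^n - b%:P \is monic by rewrite monicXnsubC.
pose g := q %% ('X^n - b%:P).
have size_g : (size g <= n)%N.
  by rewrite -ltnS -(size_XnsubC b n_gt0) ltn_modpN0 ?monic_neq0.
have map_Xnb z : z ^+ n = y ^+ n -> (map_poly iota ('X^n - b%:P)).[z] = 0.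
  by rewrite rmorphB /= map_polyXn map_polyC !hornerE y_pow_n => ->;
    rewrite subrr.
have eval_g z :
    z ^+ n = y ^+ n -> (map_poly iota q).[z] = (map_poly iota g).[z].
  move=> /map_Xnb Xnb_z; rewrite (divp_eq q ('X^n - b%:P)) rmorphD rmorphM /=.
  by rewrite hornerD hornerM Xnb_z mulr0 add0r.
have f_conj z : z ^+ n = y ^+ n -> root (map_poly iota f) (map_poly iota g).[z].
  move=> zn; have : 'X^n - b%:P %| f \Po q.
    by apply: binomial_dvd_annihilator; rewrite map_comp_poly rootE horner_comp.
  case/dvdpP=> h /(congr1 (map_poly iota)); rewrite map_comp_poly rmorphM /=.
  move/(congr1 (fun p => p.[z])); rewrite horner_comp hornerM map_Xnb // mulr0.
  by rewrite -eval_g // => fz; apply/rootP.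
have [z zn|d def_d] := horner_real_conjugates_square nz_y size_g.
  exact: f_real (f_conj z zn).
apply: (@cubic_root_of_common_quadratic_root F C iota f
          (('X - (g`_0)%:P) ^+ 2 - d%:P) (map_poly iota g).[y]) => //.
- rewrite -size_poly_gt0 size_polyDl ?size_exp_XsubC //.
  by rewrite size_polyN size_polyC; case: (d != 0).
- rewrite size_polyDl ?size_exp_XsubC //.
  by rewrite size_polyN size_polyC; case: (d != 0).
- exact: f_conj.
by rewrite rootE !rmorphE /= !map_polyX !map_polyC !hornerE def_d subrr.
Qed.

End MinimalRadical.

Lemma cubic_root_descends_radical (C : numClosedFieldType) (F : fieldType)
    (iota : {rmorphism F -> C}) (y : C) (n : nat) (a : F) (f q : {poly F}) :
    (forall x, iota x \is Num.real) -> y \is Num.real ->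
    (0 < n)%N -> y ^+ n = iota a ->
    size f = 4%N -> (forall z, root (map_poly iota f) z -> z \is Num.real) ->
    root (map_poly iota f) (map_poly iota q).[y] ->
  exists x, root f x.
Proof.
move=> iota_real y_real n_gt0 yn size_f f_real fq.
pose P m := (0 < m)%N && `[< exists c, y ^+ m = iota c >].
have exP : exists m, P m by exists n; rewrite /P n_gt0; apply/asboolP; exists a.
have [m /andP[m_gt0 /asboolP[c ymc]] m_min] := ex_minnP exP.
apply: (@cubic_root_descends C F iota iota_real y m c y_real) fq => //.
by move=> k d k_gt0 ykd; apply: m_min; rewrite /P k_gt0;
  apply/asboolP; exists d.
Qed.

(** * Fields of real numbers without a root of the cubic *)

(** The invariant of a calculator sequence with set of terms S. The field is an
abstract one with an embedding, so that one radical can be adjoined by the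
generic construction [subFExtend]. *)
Definition rootless_real_field (C : numClosedFieldType) (P : {poly C})
    (S : C -> Prop) : Prop :=
  exists (F : fieldType) (iota : {rmorphism F -> C}) (f : {poly F}),
    [/\ map_poly iota f = P, forall x, iota x \is Num.real,
        forall x, ~~ root f x & forall z, S z -> exists x, iota x = z].

(** The elements of F(y) are the q(y) with q over F, so they are real, and a
root of P among them would descend to F. *)
Lemma rootless_real_field_radical (C : numClosedFieldType) (P : {poly C})
    (S : C -> Prop) (y a : C) (n : nat) :
    size P = 4%N -> (forall z, root P z -> z \is Num.real) ->
    rootless_real_field P S ->
    y \is Num.real -> (0 < n)%N -> S a -> y ^+ n = a ->
  rootless_real_field P (fun z => S z \/ z = y).
Proof.
move=> size_P P_real [F [iota [f [def_P iota_real f_rootless iota_S]]]].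
move=> y_real n_gt0 /iota_S[b <-] yn.
pose p := 'X^n - b%:P.
have nz_p : p != 0 by rewrite monic_neq0 // monicXnsubC.
have py : root (map_poly iota p) y.
  by rewrite rootE rmorphB /= map_polyXn map_polyC !hornerE yn subrr.
pose j : {rmorphism F -> subFExtend iota y p} := inj_subfx iota y p.
pose k : {rmorphism subFExtend iota y p -> C} := @subfx_inj _ _ iota y p.
have eval_y q : k (subfx_eval iota y p q) = (map_poly iota q).[y].
  exact: subfx_inj_eval.
have jE x : k (j x) = iota x.
  by have := eval_y x%:P; rewrite map_polyC hornerC.
exists (subFExtend iota y p), k, (map_poly j f); split.
- by rewrite -map_poly_comp -def_P; apply: eq_map_poly.
- move=> x; have [q ->] := subfxE x; rewrite eval_y; apply: rpred_horner => //.
  by apply/polyOverP => i; rewrite coef_map; apply: iota_real.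
- move=> x; apply/negP => fx; have [q def_x] := subfxE x.
  have : exists x0, root f x0.
    apply: (@cubic_root_descends_radical C F iota y n b f q) => //.
    + by rewrite -(size_map_poly iota) def_P.
    + by rewrite def_P.
    rewrite -eval_y -def_x def_P.
    have <- : map_poly k (map_poly j f) = P.
      by rewrite -map_poly_comp -def_P; apply: eq_map_poly.
    by rewrite fmorph_root.
  by case=> x0; apply/negP.
move=> z [/iota_S[x <-]|->]; first by exists (j x).
by exists (subfx_eval iota y p 'X); rewrite eval_y map_polyX hornerX.
Qed.

(** * Calculator sequences *)

Lemma calculator_sequence_rcons (R : realType) (s : seq R) (x : R) :
  calculator_sequence (rcons s x) ->
  calculator_sequence s /\ calculator_step s x.
Proof.
move=> sx; split=> [k k_lt|]; last first.
  have := sx (size s); rewrite size_rcons nth_rcons ltnn eqxx -cats1.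
  by rewrite take_size_cat //; apply.
have := sx k; rewrite size_rcons nth_rcons k_lt -cats1 takel_cat;
  last exact: ltnW.
by apply; exact: ltnW.
Qed.

Lemma calculator_sequence_rootless (R : realType) (P : {poly R[i]})
    (s : seq R) :
    size P = 4%N -> (forall z, root P z -> z \is Num.real) ->
    rootless_real_field P (fun _ => False) -> calculator_sequence s ->
  rootless_real_field P (fun z => exists2 x, x \in s & z = x%:C%C).
Proof.
move=> size_P P_real P0; elim/last_ind: s => [|s y IHs].
  move=> _; case: P0 => F [iota [f [? ? ? _]]].
  by exists F, iota, f; split=> // z [].
move=> /calculator_sequence_rcons[/IHs Ps y_step] {IHs}.
have mem_rcons_s F (iota : {rmorphism F -> R[i]}) :
    (forall z, (exists2 x, x \in s & z = x%:C%C) -> exists x, iota x = z) ->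
    (exists x, iota x = y%:C%C) ->
    forall z, (exists2 x, x \in rcons s y & z = x%:C%C) -> exists x, iota x = z.
  move=> iota_s iota_y z [x]; rewrite mem_rcons in_cons.
  move=> /orP[/eqP->|xs] -> //.
  by apply: iota_s; exists x.
have from_field (F : fieldType) (iota : {rmorphism F -> R[i]}) (f : {poly F}) :
    map_poly iota f = P -> (forall x, iota x \is Num.real) ->
    (forall x, ~~ root f x) ->
    (forall z, (exists2 x, x \in s & z = x%:C%C) -> exists x, iota x = z) ->
    (exists x, iota x = y%:C%C) ->
    rootless_real_field P (fun z => exists2 x, x \in rcons s y & z = x%:C%C).
  by move=> ? ? ? iota_s iota_y; exists F, iota, f; split=> //;
    apply: mem_rcons_s.
case: y_step => [y1|[[a [b [as_ bs y_ab]]]|[n [a [n_ge2 as_ [yn _]]]]]].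
- case: Ps => F [iota [f [? ? ? ?]]]; apply: (from_field F iota f) => //.
  by exists 1; rewrite y1 !rmorph1.
- case: Ps => F [iota [f [? ? ? iota_s]]]; apply: (from_field F iota f) => //.
  have [|u iota_u] := iota_s a%:C%C; first by exists a.
  have [|v iota_v] := iota_s b%:C%C; first by exists b.
  case: y_ab => [->|->|->|[_ ->]].
  + by exists (u + v); rewrite !rmorphD /= iota_u iota_v.
  + by exists (u - v); rewrite !rmorphB /= iota_u iota_v.
  + by exists (u * v); rewrite !rmorphM /= iota_u iota_v.
  + by exists (u / v); rewrite !fmorph_div /= iota_u iota_v.
have [||||F [iota [f [? ? ? iota_sy]]]] := @rootless_real_field_radical
    _ P _ y%:C%C a%:C%C n size_P P_real Ps.
- by rewrite complex_real.
- exact: ltnW.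
- by exists a.
- by rewrite -rmorphXn yn.
apply: (from_field F iota f) => //; first by move=> z sz; apply: iota_sy; left.
by apply: iota_sy; right.
Qed.

Theorem casus_irreducibilis (R : realType) (p : {poly rat}) :
    size p = 4%N ->
    (forall z : R[i], root (map_poly ratr p) z -> z \is Num.real) ->
    (forall x : rat, ~~ root p x) ->
  cubic_without_obtainable_root R p.
Proof.
move=> size_p p_real p_rootless; split=> // x px [s].
have size_P : size (map_poly ratr p : {poly R[i]}) = 4%N.
  by rewrite size_map_poly.
move/(calculator_sequence_rootless size_P p_real).
case=> [|F [iota [f [def_P _ f_rootless iota_s]]]].
  exists rat, ratr, p; split=> // a.
  by rewrite rpred_rat.
have [|u iota_u] := iota_s x%:C%C.
  by exists x => //; rewrite mem_rcons mem_head.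
case/negP: (f_rootless u); rewrite -(fmorph_root iota) def_P iota_u.
have -> : map_poly ratr p = map_poly (real_complex R) (map_poly ratr p).
  by rewrite -map_poly_comp; apply: eq_map_poly => c /=; rewrite fmorph_rat.
by rewrite fmorph_root.
Qed.

(** * The cubic of the regular nonagon *)

Lemma size_nonagon_cubic :
  size (8%:R *: 'X^3 - 6%:R *: 'X + 1 : {poly rat}) = 4%N.
Proof.
rewrite -addrA size_polyDl size_scale ?size_polyXn //.
rewrite -scaleNr -polyC1 -mul_polyC size_MXaddC.
by case: ifP => // _; rewrite size_polyC.
Qed.

Lemma nonagon_cubic_horner (K : fieldType) (j : {rmorphism rat -> K}) (z : K) :
  (map_poly j (8%:R *: 'X^3 - 6%:R *: 'X + 1)).[z] = 8 * z ^+ 3 - 6 * z + 1.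
Proof.
rewrite rmorphD rmorphB /= !map_polyZ /= map_polyXn map_polyX rmorph1.
by rewrite !rmorph_nat !hornerE.
Qed.

(** With z = (t + 1/t) / 2 the equation becomes t^6 + t^3 + 1 = 0, so t^9 = 1.
Hence |t| = 1, 1/t is the conjugate of t, and z is the real part of t. *)
Lemma nonagon_cubic_real (C : numClosedFieldType) (z : C) :
  8 * z ^+ 3 - 6 * z + 1 = 0 -> z \is Num.real.
Proof.
move=> fz; pose t := z + sqrtC (z ^+ 2 - 1).
have quad : t ^+ 2 - 2 * z * t + 1 = 0.
  have := sqrtCK (z ^+ 2 - 1); rewrite /t; move: (sqrtC _) => w w2.
  by ring: w2.
have nz_t : t != 0.
  apply: contraPneq quad => ->; rewrite expr0n mulr0 subr0 add0r.
  exact/eqP/oner_neq0.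
have def_z : z = (t + t^-1) / 2.
  apply: (mulfI nz_t); apply: (mulfI (_ : 2 != 0 :> C)).
    by rewrite pnatr_eq0.
  have -> : 2 * (t * ((t + t^-1) / 2)) = t ^+ 2 + 1 by field; rewrite nz_t.
  by apply/eqP; rewrite -subr_eq0 -oppr_eq0 -quad; apply/eqP; ring.
have t6 : t ^+ 6 + t ^+ 3 + 1 = 0.
  have <- : t ^+ 3 * (8 * z ^+ 3 - 6 * z + 1) = t ^+ 6 + t ^+ 3 + 1.
    by rewrite def_z; field.
  by rewrite fz mulr0.
have t9 : t ^+ 9 = 1.
  have : (t ^+ 3 - 1) * (t ^+ 6 + t ^+ 3 + 1) = 0 by rewrite t6 mulr0.
  by move=> h; apply/eqP; rewrite -subr_eq0 -h; apply/eqP; ring.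
have norm_t : `|t| = 1.
  apply/eqP; rewrite -(@eqrXn2 _ 9) ?normr_ge0 ?ler01 //.
  by rewrite -normrX t9 normr1 expr1n.
have conj_t : t^* = t^-1 by rewrite invC_norm norm_t expr1n invr1 mul1r.
apply/CrealP; rewrite def_z rmorphM rmorphD /= !fmorphV /= conj_t invrK.
by rewrite (addrC t) conj_Creal ?realn.
Qed.

(** If 2 x = m / k in lowest terms, then m^3 - 3 m k^2 + k^3 = 0, and the left
hand side is odd unless both m and k are even. *)
Lemma nonagon_cubic_rootless (x : rat) : 8 * x ^+ 3 - 6 * x + 1 != 0.
Proof.
apply/eqP => fx; pose u : rat := 2 * x; pose m := numq u; pose k := denq u.
have int_eq : m ^+ 3 - 3 * m * k ^+ 2 + k ^+ 3 = 0.
  have def_m : m%:~R = u * k%:~R by rewrite numqE.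
  apply: (@intr_inj rat); rewrite -[RHS](mulr0 (k%:~R ^+ 3)) -fx.
  by rewrite /u in def_m; ring: def_m.
have parity (i : int) : exists c : int, i = 2 * c \/ i = 2 * c + 1.
  by exists (i %/ 2)%Z; lia.
have [a def_m] := parity m; have [c def_k] := parity k.
have [ma kc] : m = 2 * a /\ k = 2 * c.
  by case: def_m def_k int_eq => -> [] ->; rewrite !expr2 !exprS expr0; lia.
have := coprime_num_den u; rewrite -/m -/k ma kc !abszM => /eqP.
by rewrite -muln_gcdr; case: gcdn => [|[|?]].
Qed.

Theorem mainTheorem2 (R : realType) :
  (exists p : {poly rat}, cubic_without_obtainable_root R p) /\
  cubic_without_obtainable_root R (8%:R *: 'X^3 - 6%:R *: 'X + 1).
Proof.
suff nonagon : cubic_without_obtainable_root R (8%:R *: 'X^3 - 6%:R *: 'X + 1).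
  by split=> //; eexists; exact: nonagon.
apply: casus_irreducibilis size_nonagon_cubic _ _ => [z|x].
  by rewrite rootE nonagon_cubic_horner => /eqP; apply: nonagon_cubic_real.
rewrite -(fmorph_root idfun) rootE nonagon_cubic_horner.
exact: nonagon_cubic_rootless.
Qed.
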